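(* Let $n\ge 1$, $\mathcal{H}=(\mathbb{C}^2)^{\otimes n}$, and let $\mathcal{B}(\mathcal{H})=\bigoplus_{\kappa=0}^{2n}\mathcal{B}_\kappa$ be the decomposition of the operator space into the matchgate group modules, where $\mathcal{B}_\kappa$ is the span of all products of $\kappa$ distinct Majorana operators. For any two computational basis states $|a\rangle,|b\rangle$ with $a,b\in\{0,1\}^n$, with density matrices $\rho^a=|a\rangle\langle a|$ and $\rho^b=|b\rangle\langle b|$, one has $$\|\rho^a_\kappa\|=\|\rho^b_\kappa\|\quad\text{for all }\kappa\in\{0,1,\dots,2n\},$$ where $\rho_\kappa$ denotes the orthogonal projection of $\rho$ onto $\mathcal{B}_\kappa$.
   Context: $\mathcal{B}(\mathcal{H})$ is the space of linear operators on $\mathcal{H}$ with the Hilbert--Schmidt inner product $\langle A,B\rangle=\operatorname{Tr}[A^\dagger B]$ and norm $\|A\|=\sqrt{\langle A,A\rangle}$; orthogonal projections are with respect to this inner product. $X_i,Y_i,Z_i$ denote the Pauli operators acting on qubit $i$ (identity elsewhere). The $2n$ Majorana operators are $$c^X_\mu=Z_1\cdots Z_{\mu-1}X_\mu,\qquad c^Y_\mu=Z_1\cdots Z_{\mu-1}Y_\mu,\qquad \mu=1,\dots,n.$$ Listing them in some fixed order as $c_1,\dots,c_{2n}$, the $\kappa$-th module is $$\mathcal{B}_\kappa=\operatorname{span}_{\mathbb{C}}\{c_{i_1}c_{i_2}\cdots c_{i_\kappa}\mid 1\le i_1<\dots<i_\kappa\le 2n\},$$ with $\mathcal{B}_0=\mathbb{C}I$.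 It has dimension $\binom{2n}{\kappa}$. *)

(* Defs.v *)
From HB Require Import structures.
From mathcomp Require Import all_boot all_order all_algebra.
From mathcomp Require Import sesquilinear.
From mathcomp Require Import reals.
From mathcomp.real_closed Require Import complex mxtens.

Set Implicit Arguments.
Unset Strict Implicit.
Unset Printing Implicit Defensive.

Import Order.TTheory GRing.Theory Num.Theory.
Local Open Scope ring_scope.

Section HilbertSchmidt.
Variable C : numClosedFieldType.

Definition adjmx m n (A : 'M[C]_(m, n)) : 'M[C]_(n, m) := map_mx Num.conj A^T.

Definition hs_dot d (A B : 'M[C]_d) : C := \tr (adjmx A *m B).

Definition hs_norm d (A : 'M[C]_d) : C := sqrtC (hs_dot A A).

(* The forms of sesquilinear are linear in their first argument, whereas
   [hs_dot] is linear in the second one; hence the flipped form. *)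
Definition hs_form d (A B : 'M[C]_d) : C := hs_dot B A.

Lemma hs_dotE d (A B : 'M[C]_d) :
  hs_dot A B = \sum_i \sum_j (A i j)^* * B i j.
Proof.
rewrite /hs_dot /mxtrace exchange_big /=; apply: eq_bigr => j _.
by rewrite mxE; apply: eq_bigr => i _; rewrite !mxE.
Qed.

Lemma hs_form_linear_l d (B : 'M[C]_d) :
  GRing.linear_for *%R ((@hs_form d)^~ B).
Proof.
by move=> k A A'; rewrite /hs_form /hs_dot mulmxDr -scalemxAr mxtraceD mxtraceZ.
Qed.

Lemma hs_form_linear_r d (A : 'M[C]_d) :
  GRing.linear_for (Num.conj \; *%R) (hs_form A).
Proof.
move=> k B B'; rewrite /hs_form !hs_dotE /= mulr_sumr -big_split /=.
apply: eq_bigr => i _; rewrite mulr_sumr -big_split /=; apply: eq_bigr => j _.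
by rewrite !mxE rmorphD rmorphM /= mulrDl mulrA.
Qed.

HB.instance Definition _ d := bilinear_isBilinear.Build C
  'M[C]_d 'M[C]_d C *%R (Num.conj \; *%R) (@hs_form d)
  (@hs_form_linear_l d, @hs_form_linear_r d).

Lemma hs_form_hermitian d (A B : 'M[C]_d) :
  hs_form A B = (-1) ^+ false * (hs_form B A)^*.
Proof.
rewrite mul1r /hs_form !hs_dotE rmorph_sum; apply: eq_bigr => i _.
by rewrite rmorph_sum; apply: eq_bigr => j _; rewrite rmorphM /= conjCK mulrC.
Qed.

HB.instance Definition _ d := isHermitianSesquilinear.Build C 'M[C]_d
  false Num.conj (@hs_form d) (@hs_form_hermitian d).

Lemma hs_form_gt0 d (A : 'M[C]_d) : A != 0 -> 0 < hs_form A A.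
Proof.
move=> A0; have ge0 i j : 0 <= (A i j)^* * A i j by rewrite mulrC mul_conjC_ge0.
have sge0 i : 0 <= \sum_j (A i j)^* * A i j by apply: sumr_ge0 => j _.
rewrite /hs_form hs_dotE lt_def sumr_ge0 // andbT.
apply: contra A0 => /eqP s0; apply/eqP/matrixP => i j; rewrite mxE.
have /eqP := s0; rewrite psumr_eq0 // => /allP/(_ i (mem_index_enum _)) /=.
rewrite psumr_eq0 // => /allP/(_ j (mem_index_enum _)) /=.
by rewrite mulrC mul_conjC_eq0 => /eqP.
Qed.

HB.instance Definition _ d := isDotProduct.Build C 'M[C]_d
  (@hs_form d) (@hs_form_gt0 d).

Definition orthproj d (V : {vspace 'M[C]_d}) : 'End('M[C]_d) :=
  daddv_pi V (orthov (@hs_form d) V).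

Lemma mem_hs_orthov d (V : {vspace 'M[C]_d}) (A : 'M[C]_d) :
  reflect {in V, forall B, hs_dot B A = 0} (A \in orthov (@hs_form d) V).
Proof. exact: (iffP mem_orthovP). Qed.

Lemma hs_orthov_cap d (V : {vspace 'M[C]_d}) :
  (V :&: orthov (@hs_form d) V = 0)%VS.
Proof.
apply/eqP; rewrite -subv0; apply/subvP => A; rewrite memv_cap => /andP[AV].
move/mem_hs_orthov/(_ _ AV) => A0; rewrite memv0; apply/eqP.
by apply: contraTeq isT => /hs_form_gt0; rewrite /hs_form A0 ltxx.
Qed.

Lemma hs_orthov_add d (V : {vspace 'M[C]_d}) :
  (V + orthov (@hs_form d) V = fullv)%VS.
Proof.
pose f (A : 'M[C]_d) : 'rV[C]_(\dim V) := \row_i hs_form A (vbasis V)`_i.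
have f_lin : linear f.
  by move=> k A B; apply/rowP => i; rewrite !mxE hs_form_linear_l.
pose fL := GRing.isLinear.Build _ _ _ _ f f_lin.
pose F : {linear 'M[C]_d -> 'rV[C]_(\dim V)} := HB.pack f fL.
have kerF : (lker (linfun F) <= orthov (@hs_form d) V)%VS.
  apply/subvP => A; rewrite memv_ker lfunE => /eqP/rowP FA.
  apply/mem_orthovP => B /coord_vbasis->; rewrite linear_sumr big1 // => i _.
  by have := FA i; rewrite !mxE linearZr_LR /= => ->; rewrite mulr0.
apply/eqP; rewrite eqEdim subvf /= dimv_disjoint_sum ?hs_orthov_cap //.
have <- := limg_ker_dim (linfun F) fullv.
rewrite capfv addnC leq_add ?dimvS //.
by rewrite (leq_trans (dimvS (subvf _))) // dimvf /dim /= mul1n.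
Qed.

Lemma orthproj_mem d (V : {vspace 'M[C]_d}) A : orthproj V A \in V.
Proof. exact: memv_pi. Qed.

Lemma orthproj_ortho d (V : {vspace 'M[C]_d}) A :
  {in V, forall B, hs_dot B (A - orthproj V A) = 0}.
Proof.
apply/mem_hs_orthov; have cap0 := hs_orthov_cap V.
have /(daddv_pi_add cap0) {1}<- : A \in (V + orthov (@hs_form d) V)%VS.
  by rewrite hs_orthov_add memvf.
by rewrite /orthproj addrC addKr memv_pi.
Qed.

End HilbertSchmidt.

Section Qubits.
Variable C : numClosedFieldType.

Fixpoint bigtens_rec p q k : ('I_k.+1 -> 'M[C]_(p, q)) ->
    'M[C]_(p ^ k.+1, q ^ k.+1) :=
  match k with
  | 0 => fun A => A ord0
  | k'.+1 => fun A => A ord0 *t bigtens_rec (fun i => A (lift ord0 i))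
  end.

(* The Kronecker product A_0 (x) ... (x) A_(n-1), with the same recursion as
   [ntensmx]. Qubits are numbered from 0. *)
Definition bigtens p q n : ('I_n -> 'M[C]_(p, q)) -> 'M[C]_(p ^ n, q ^ n) :=
  match n with
  | 0 => fun _ => 1
  | k.+1 => fun A => bigtens_rec A
  end.

Definition mx2 (x y z t : C) : 'M[C]_2 :=
  \matrix_(i, j) (if i == 0 then if j == 0 then x else y
                  else if j == 0 then z else t).

Definition pauliX : 'M[C]_2 := mx2 0 1 1 0.
Definition pauliY : 'M[C]_2 := mx2 0 (- 'i) 'i 0.
Definition pauliZ : 'M[C]_2 := mx2 1 0 0 (- 1).

Definition on_qubit n (P : 'M[C]_2) (i : 'I_n) : 'M[C]_(2 ^ n) :=
  bigtens (fun j => if j == i then P else 1%:M).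

Definition jw_string n (mu : 'I_n) : 'M[C]_(2 ^ n) :=
  \prod_(j < n | (j < mu)%N) on_qubit pauliZ j.

Definition majoranaX n (mu : 'I_n) : 'M[C]_(2 ^ n) :=
  jw_string mu *m on_qubit pauliX mu.
Definition majoranaY n (mu : 'I_n) : 'M[C]_(2 ^ n) :=
  jw_string mu *m on_qubit pauliY mu.

(* The chosen listing is c^X_0, ..., c^X_(n-1), c^Y_0, ..., c^Y_(n-1). *)
Definition majorana n (k : 'I_(n + n)) : 'M[C]_(2 ^ n) :=
  match split k with
  | inl mu => majoranaX mu
  | inr mu => majoranaY mu
  end.

(* The indices of a strictly increasing family i_1 < ... < i_kappa are given by
   their set J; [\prod_(i in J)] multiplies in increasing order of i. *)
Definition majorana_monomial n (J : {set 'I_(n + n)}) : 'M[C]_(2 ^ n) :=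
  \prod_(i in J) majorana i.

Definition majorana_module n (kappa : nat) : {vspace 'M[C]_(2 ^ n)} :=
  span [seq majorana_monomial J | J in [set J : {set 'I_(n + n)} |
                                         #|J| == kappa]].

Definition basis_ket n (a : {ffun 'I_n -> 'I_2}) : 'cV[C]_(2 ^ n) :=
  castmx (erefl _, exp1n n) (bigtens (fun i => delta_mx (a i) 0)).

Definition pure_density n (psi : 'cV[C]_(2 ^ n)) : 'M[C]_(2 ^ n) :=
  psi *m adjmx psi.

End Qubits.

(* Main.v *)
(** Let U be the tensor product of X on the qubits where a and b differ and of 1
    elsewhere. Conjugation by U maps every Pauli operator acting on one qubit to
    plus or minus itself, hence every Majorana monomial to plus or minus itself.
    So it is a Hilbert-Schmidt isometry that preserves each module, and therefore
    commutes with the projections; it maps rho^a to rho^b. *)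
Require Import Defs.
From mathcomp Require Import all_boot all_order all_algebra.
From mathcomp Require Import reals.
From mathcomp.real_closed Require Import complex mxtens.

Set Implicit Arguments.
Unset Strict Implicit.
Unset Printing Implicit Defensive.

Import Order.TTheory GRing.Theory Num.Theory.
Local Open Scope ring_scope.

(** * Conjugation and Hilbert-Schmidt projections *)

Section Conjugation.
Variable C : numClosedFieldType.

Lemma adjmxM m n p (A : 'M[C]_(m, n)) (B : 'M[C]_(n, p)) :
  adjmx (A *m B) = adjmx B *m adjmx A.
Proof. by rewrite /adjmx trmx_mul map_mxM. Qed.

Lemma adjmxK m n (A : 'M[C]_(m, n)) : adjmx (adjmx A) = A.
Proof. by apply/matrixP => i j; rewrite !mxE conjCK. Qed.

Lemma adjmx1 n : adjmx (1%:M : 'M[C]_n) = 1%:M.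
Proof. by rewrite /adjmx trmx1 map_mx1. Qed.

Lemma adjmx_tens m n p q (A : 'M[C]_(m, n)) (B : 'M[C]_(p, q)) :
  adjmx (A *t B) = adjmx A *t adjmx B.
Proof. by apply/matrixP => i j; rewrite !mxE rmorphM. Qed.

Lemma tensmx1 m n : (1%:M : 'M[C]_m) *t (1%:M : 'M[C]_n) = 1%:M.
Proof.
apply/matrixP => i j.
case: (mxtens_indexP i) => i0 i1; case: (mxtens_indexP j) => j0 j1.
rewrite tensmxE !mxE (can_eq (@mxtens_indexK m n)) xpair_eqE.
by rewrite -natrM mulnb.
Qed.

Definition conjmx d (U A : 'M[C]_d) : 'M[C]_d := U *m A *m adjmx U.

Lemma pure_density_mul n (U : 'M[C]_(2 ^ n)) psi :
  pure_density (U *m psi) = conjmx U (pure_density psi).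
Proof. by rewrite /pure_density /conjmx adjmxM !mulmxA. Qed.

(** Cyclicity of the trace moves the left factor [U] of the conjugate to the other argument. *)
Lemma hs_dot_conjmx_adj d (U A B : 'M[C]_d) :
  hs_dot A (conjmx U B) = hs_dot (conjmx (adjmx U) A) B.
Proof.
rewrite /hs_dot /conjmx !adjmxM !adjmxK mulmxA mxtrace_mulC.
by rewrite !mulmxA.
Qed.

Lemma conjmxK d (U : 'M[C]_d) :
  adjmx U *m U = 1%:M -> cancel (conjmx U) (conjmx (adjmx U)).
Proof.
move=> UU A; rewrite /conjmx adjmxK !mulmxA UU mul1mx.
by rewrite -mulmxA UU mulmx1.
Qed.

Lemma hs_norm_conjmx d (U A : 'M[C]_d) :
  adjmx U *m U = 1%:M -> hs_norm (conjmx U A) = hs_norm A.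
Proof. by move=> UU; rewrite /hs_norm hs_dot_conjmx_adj conjmxK. Qed.

Lemma orthproj_unique d (V : {vspace 'M[C]_d}) (A P : 'M[C]_d) :
  P \in V -> {in V, forall B, hs_dot B (A - P) = 0} -> orthproj V A = P.
Proof.
move=> PV PA; apply/eqP; rewrite -subr_eq0 -memv0 -(hs_orthov_cap V) memv_cap.
rewrite memvB ?orthproj_mem //=.
(* The difference lies in [V]; as a difference of two residuals it is also orthogonal to [V]. *)
have -> : orthproj V A - P = (A - P) - (A - orthproj V A).
  by rewrite opprB [RHS]addrC addrA subrK.
by apply: memvB; apply/mem_hs_orthov => //; apply: orthproj_ortho.
Qed.

Lemma orthproj_conjmx d (V : {vspace 'M[C]_d}) (U A : 'M[C]_d) :
  {in V, forall B, conjmx U B \in V} ->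
  {in V, forall B, conjmx (adjmx U) B \in V} ->
  orthproj V (conjmx U A) = conjmx U (orthproj V A).
Proof.
move=> VU VU'; apply: orthproj_unique => [|B BV].
  exact/VU/orthproj_mem.
(* The residual is the conjugate of the residual of [A]; moving the conjugation onto [B] keeps [B]
   in [V]. *)
rewrite -[_ - _]mulmxBl -mulmxBr -/(conjmx _ _) hs_dot_conjmx_adj.
exact/orthproj_ortho/VU'.
Qed.

(** The eigenvalue is left existential: for the stability of a span it is enough that each generator
    is rescaled. *)
Definition conj_eigen d (U A : 'M[C]_d) := exists e, conjmx U A = e *: A.

Lemma conj_eigen1 d (U : 'M[C]_d) : U *m adjmx U = 1%:M -> conj_eigen U 1%:M.
Proof. by move=> UU; exists 1; rewrite /conjmx mulmx1 UU scale1r. Qed.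

(** The inner [adjmx U *m U] cancels between the two conjugates, so eigenvalues multiply. *)
Lemma conj_eigenM d (U A B : 'M[C]_d) : adjmx U *m U = 1%:M ->
  conj_eigen U A -> conj_eigen U B -> conj_eigen U (A *m B).
Proof.
move=> UU [e eA] [f fB]; exists (e * f).
rewrite -scalerA scalemxAr -fB scalemxAl -eA /conjmx !mulmxA.
by rewrite -[_ *m adjmx U *m U]mulmxA UU mulmx1.
Qed.

Lemma conj_eigen_prod d (U : 'M[C]_d) I (r : seq I) (P : pred I) F :
  U *m adjmx U = 1%:M -> (forall i, P i -> conj_eigen U (F i)) ->
  conj_eigen U (\prod_(i <- r | P i) F i).
Proof.
move=> UU FU; apply: big_ind => //; first exact: conj_eigen1.
(* A right inverse of a square matrix is also a left inverse. *)
by move=> A B; apply: conj_eigenM; apply: mulmx1C.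
Qed.

Lemma span_conjmx d (U : 'M[C]_d) (s : seq 'M[C]_d) :
  {in s, forall A, conj_eigen U A} ->
  {in <<s>>%VS, forall A, conjmx U A \in <<s>>%VS}.
Proof.
move=> sU A /(@coord_span _ _ _ (in_tuple s)) ->.
rewrite /conjmx mulmx_sumr mulmx_suml; apply: memv_suml => i _.
rewrite -scalemxAr -scalemxAl memvZ //.
have si : s`_i \in s by rewrite mem_nth.
by have [e] := sU _ si; rewrite /conjmx => ->; rewrite memvZ // memv_span.
Qed.

(** * Factorwise calculus of Kronecker products *)

Lemma bigtens_mul p q r n (A : 'I_n -> 'M[C]_(p, q)) (B : 'I_n -> 'M[C]_(q, r)) :
  bigtens A *m bigtens B = bigtens (fun i => A i *m B i).
Proof.
(* The empty product is the 1 by 1 identity; the recursion starts at one factor. *)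
case: n A B => [|n] A B /=; first exact: mul1mx.
by elim: n A B => [|n IHn] A B //=; rewrite -IHn; apply: tensmx_mul.
Qed.

Lemma adjmx_bigtens p q n (A : 'I_n -> 'M[C]_(p, q)) :
  adjmx (bigtens A) = bigtens (fun i => adjmx (A i)).
Proof.
case: n A => [|n] A /=; first exact: adjmx1.
by elim: n A => [|n IHn] A //=; rewrite -IHn; apply: adjmx_tens.
Qed.

Lemma eq_bigtens p q n (A B : 'I_n -> 'M[C]_(p, q)) :
  A =1 B -> bigtens A = bigtens B.
Proof.
case: n A B => [|n] A B //= AB.
elim: n A B AB => [|n IHn] A B AB /=; first exact: AB.
by rewrite AB (IHn _ (fun i => B (lift ord0 i))).
Qed.

Lemma bigtensZ p q n (e : 'I_n -> C) (A : 'I_n -> 'M[C]_(p, q)) :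
  bigtens (fun i => e i *: A i) = (\prod_i e i) *: bigtens A.
Proof.
case: n e A => [|n] e A /=; first by rewrite big_ord0 scale1r.
elim: n e A => [|n IHn] e A /=; first by rewrite big_ord1.
rewrite IHn [in RHS]big_ord_recl; apply/matrixP => i j; rewrite !mxE.
by rewrite mulrACA.
Qed.

Lemma bigtens1 p n : bigtens (fun _ : 'I_n => 1%:M : 'M[C]_p) = 1%:M.
Proof.
case: n => [|n] //=.
elim: n => [|n IHn] //=; rewrite IHn; exact: tensmx1.
Qed.

Lemma conjmx_bigtens p n (W A : 'I_n -> 'M[C]_p) :
  conjmx (bigtens W) (bigtens A) = bigtens (fun i => conjmx (W i) (A i)).
Proof. by rewrite /conjmx adjmx_bigtens !bigtens_mul. Qed.

Lemma conj_eigen_bigtens p n (W A : 'I_n -> 'M[C]_p) :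
  (forall i, conj_eigen (W i) (A i)) -> conj_eigen (bigtens W) (bigtens A).
Proof.
(* Choose one eigenvalue per factor; multilinearity pulls out their product. *)
move=> /fin_all_exists[e We]; exists (\prod_i e i).
by rewrite conjmx_bigtens (eq_bigtens We) bigtensZ.
Qed.

Lemma bigtens_unitary p n (W : 'I_n -> 'M[C]_p) :
  (forall i, W i *m adjmx (W i) = 1%:M) ->
  bigtens W *m adjmx (bigtens W) = 1%:M.
Proof.
by move=> WW; rewrite adjmx_bigtens bigtens_mul (eq_bigtens WW) bigtens1.
Qed.

End Conjugation.

(** * Bit flips acting on Pauli and Majorana operators *)

Section BitFlip.
Variable C : numClosedFieldType.

Lemma mx2_mul (x y z t x' y' z' t' : C) :
  mx2 x y z t *m mx2 x' y' z' t' =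
  mx2 (x * x' + y * z') (x * y' + y * t') (z * x' + t * z') (z * y' + t * t').
Proof.
apply/matrixP => i j; rewrite !mxE !big_ord_recl big_ord0 addr0 !mxE /=.
by case: (i == 0); case: (j == 0).
Qed.

Lemma mx2Z (e x y z t : C) :
  e *: mx2 x y z t = mx2 (e * x) (e * y) (e * z) (e * t).
Proof.
by apply/matrixP => i j; rewrite !mxE; case: (i == 0); case: (j == 0).
Qed.

Lemma adjmx_pauliX : adjmx (pauliX C) = pauliX C.
Proof.
apply/matrixP => i j; rewrite !mxE.
by case: (i == 0); case: (j == 0); rewrite ?rmorph1 ?rmorph0.
Qed.

Definition flip_gate (b : bool) : 'M[C]_2 := if b then pauliX C else 1%:M.

Lemma adjmx_flip_gate b : adjmx (flip_gate b) = flip_gate b.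
Proof. by case: b; [apply: adjmx_pauliX | apply: adjmx1]. Qed.

Lemma flip_gate_invol b : flip_gate b *m flip_gate b = 1%:M.
Proof.
case: b; rewrite /= ?mulmx1 // mx2_mul !(mulr0, mul0r, mulr1, add0r, addr0).
by apply/matrixP => -[[|[|i]] //= iP] [[|[|j]] //= jP]; rewrite !mxE.
Qed.

Lemma flip_gate_ket (i j : 'I_2) :
  flip_gate (i != j) *m delta_mx i (0 : 'I_1) = delta_mx j 0.
Proof.
have [->|ij] := eqVneq i j; first exact: mul1mx.
apply/matrixP => k l; rewrite ord1 !mxE !big_ord_recl big_ord0 !mxE /=.
case: i j k ij => [[|[|//]] iP] [[|[|//]] jP] [[|[|//]] kP] //= _;
by rewrite ?(mulr0, mul0r, mulr1, add0r, addr0).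
Qed.

Lemma flip_gate_pauliX b : conj_eigen (flip_gate b) (pauliX C).
Proof.
exists 1; rewrite /conjmx adjmx_flip_gate scale1r.
by case: b => /=; rewrite ?(flip_gate_invol true) -?mulmxA
  ?(flip_gate_invol true) ?mul1mx ?mulmx1.
Qed.

Lemma flip_gate_pauliY b : conj_eigen (flip_gate b) (pauliY C).
Proof.
(* The Pauli matrices X and Y anticommute, so the sign is -1 exactly when the gate is X. *)
exists ((-1) ^+ b); rewrite /conjmx adjmx_flip_gate.
case: b => /=; last by rewrite mul1mx mulmx1 scale1r.
by rewrite expr1 !mx2_mul mx2Z !(mulr0, mul0r, mulr1, mul1r, add0r, addr0,
  mulN1r, opprK, oppr0).
Qed.

Lemma flip_gate_pauliZ b : conj_eigen (flip_gate b) (pauliZ C).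
Proof.
(* X anticommutes with Z as well. *)
exists ((-1) ^+ b); rewrite /conjmx adjmx_flip_gate.
case: b => /=; last by rewrite mul1mx mulmx1 scale1r.
by rewrite expr1 !mx2_mul mx2Z !(mulr0, mul0r, mulr1, mul1r, add0r, addr0,
  mulN1r, opprK, oppr0).
Qed.

Variable n : nat.
Variable s : 'I_n -> bool.

(** The pattern [s] is arbitrary here; it is later set to the qubits where [a] and [b] differ. *)
Definition flip : 'M[C]_(2 ^ n) := bigtens (fun i => flip_gate (s i)).

Lemma adjmx_flip : adjmx flip = flip.
Proof.
by rewrite adjmx_bigtens; apply: eq_bigtens => i; rewrite adjmx_flip_gate.
Qed.

Lemma flip_unitary : flip *m adjmx flip = 1%:M.
Proof.
by apply: bigtens_unitary => i; rewrite adjmx_flip_gate flip_gate_invol.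
Qed.

Lemma flip_on_qubit (P : 'M[C]_2) i :
  (forall b, conj_eigen (flip_gate b) P) -> conj_eigen flip (on_qubit P i).
Proof.
(* Away from qubit [i] the factor is the identity, which a unitary conjugation fixes. *)
move=> Pb; apply: conj_eigen_bigtens => j; case: eqP => // _.
by apply: conj_eigen1; rewrite adjmx_flip_gate flip_gate_invol.
Qed.

Lemma flip_majorana k : conj_eigen flip (majorana C k).
Proof.
have jw mu : conj_eigen flip (jw_string C mu).
  apply: conj_eigen_prod flip_unitary _ => i _.
  exact: flip_on_qubit flip_gate_pauliZ.
rewrite /majorana; case: (split k) => mu;
  apply: conj_eigenM (mulmx1C flip_unitary) (jw mu) _.
  exact: flip_on_qubit flip_gate_pauliX.
exact: flip_on_qubit flip_gate_pauliY.
Qed.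

Lemma flip_majorana_module kappa :
  {in majorana_module C n kappa, forall A,
     conjmx flip A \in majorana_module C n kappa}.
Proof.
apply: span_conjmx => A /imageP[J _ ->].
by apply: conj_eigen_prod flip_unitary _ => i _; apply: flip_majorana.
Qed.

Lemma hs_norm_orthproj_flip kappa (A : 'M[C]_(2 ^ n)) :
  hs_norm (orthproj (majorana_module C n kappa) (conjmx flip A)) =
  hs_norm (orthproj (majorana_module C n kappa) A).
Proof.
(* As [flip] is self-adjoint, both stability conditions become the same one. *)
rewrite orthproj_conjmx ?adjmx_flip; try exact: flip_majorana_module.
exact/hs_norm_conjmx/mulmx1C/flip_unitary.
Qed.

End BitFlip.

(** * Passing from one basis state to another *)

Lemma flip_basis_ket (C : numClosedFieldType) n (a b : {ffun 'I_n -> 'I_2}) :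
  flip C (fun i => a i != b i) *m basis_ket C a = basis_ket C b.
Proof.
(* The cast in [basis_ket] turns [1 ^ n] columns into one; left multiplication does not touch the
   column count. *)
have mul_cast p q r r' (e : r = r') (A : 'M[C]_(p, q)) (B : 'M[C]_(q, r)) :
    A *m castmx (erefl _, e) B = castmx (erefl _, e) (A *m B).
  by case: r' / e; rewrite !castmx_id.
rewrite /basis_ket mul_cast bigtens_mul; congr castmx.
by apply: eq_bigtens => i; apply: flip_gate_ket.
Qed.

Theorem mainTheorem2 (R : realType) (n : nat) (hn : (1 <= n)%N)
  (a b : {ffun 'I_n -> 'I_2}) :
  forall kappa : nat, (kappa <= 2 * n)%N ->
    hs_norm (orthproj (majorana_module R[i] n kappa)
                      (pure_density (basis_ket R[i] a))) =
    hs_norm (orthproj (majorana_module R[i] n kappa)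
                      (pure_density (basis_ket R[i] b))).
Proof.
move=> kappa _; rewrite -(flip_basis_ket _ a b) pure_density_mul.
by rewrite hs_norm_orthproj_flip.
Qed.
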